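(* Let $p$ be a prime and let $f(x)=\sum_{k=k_a}^{k_b}c_kx^k\in\mathbb{F}_p[x,x^{-1}]$ with $k_a<k_b$, $c_{k_a}\ne0$, $c_{k_b}\neq0$, $f(1)\ne0$. Let $l_x,l_y\ge0$ be integers. Then for all sufficiently large $N$, with $L=p^N$, the following holds. Let $\mathbf{F}\in\mathbb{F}_p^{L\times L}$ be the (invertible) matrix of $f$, and let $\mathbf{W}\in\mathbb{F}_p^{L\times L}$ be a matrix such that for every integer $n$ the matrix $$(\mathbf{F}^{n})^{T}\,\mathbf{W}\,\mathbf{F}^{n}$$ has nonzero $(i',i)$ entries only when $i'-i$ is congruent modulo $L$ to an integer in the interval $[-l_x-2l_yk_b,\; l_x-2l_yk_a]$. Then $\mathbf{W}=0$. (That is, the only consistently local matrix of twist phases for a single fractal symmetry $\mathbb{Z}_p^{(f,y)}$ is the trivial one.)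
   Context: Rows and columns of $L\times L$ matrices are indexed by $\mathbb{Z}/L$. The matrix $\mathbf{F}$ of $f$ is the circulant matrix representing multiplication by $f(x)$ on $\mathbb{F}_p[x]/\langle x^L-1\rangle$ in the basis $1,x,\dots,x^{L-1}$, i.e. $F_{i'i}=\sum_{k\equiv i'-i \bmod L}c_k$; it is invertible because $f(1)\neq0$ and $L$ is a power of $p$. *)

(* Defs.v *)
From mathcomp Require Import all_boot all_order all_algebra.

Set Implicit Arguments.
Unset Strict Implicit.
Unset Printing Implicit Defensive.

Import Order.TTheory GRing.Theory Num.Theory.
Local Open Scope ring_scope.

(* The integers a, a + 1, ..., b (none if b < a). *)
Definition zrange (a b : int) : seq int :=
  if a <= b then [seq a + j%:Z | j <- iota 0 `|b - a|.+1] else [::].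

Lemma mem_zrange (a b k : int) : (k \in zrange a b) = (a <= k <= b).
Proof.
rewrite /zrange; case: (lerP a b) => [ab | ba]; last first.
  by rewrite in_nil; apply/esym/negbTE/negP => /andP[/le_trans h /h]; rewrite leNgt ba.
have hn : (`|b - a|%N%:Z = b - a) by rewrite gez0_abs ?subr_ge0.
apply/mapP/andP => [[j]|[ak kb]].
  rewrite mem_iota add0n ltnS /= => jn ->; split; first by rewrite lerDl.
  by rewrite addrC -lerBrDr -hn lez_nat.
have hk : (`|k - a|%N%:Z = k - a) by rewrite gez0_abs ?subr_ge0.
exists `|k - a|%N; last by rewrite hk addrC subrK.
by rewrite mem_iota add0n ltnS /= -lez_nat hk hn lerD2r.
Qed.

Lemma zrange_uniq (a b : int) : uniq (zrange a b).
Proof.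
rewrite /zrange; case: ifP => // _; rewrite map_inj_uniq ?iota_uniq //.
by move=> i j /addrI [].
Qed.

(* A Laurent polynomial sum_(a <= k <= b) c_k x^k is given by its coefficient
   function c and the bounds a, b; values of c outside [a, b] are ignored. *)
Definition laurent_eval (R : unitRingType) (c : int -> R) (a b : int) (x : R)
    : R :=
  \sum_(k <- zrange a b) c k * x ^ k.

(* 'Z_L is 'I_((Zp_trunc L).+2), and (Zp_trunc L).+2 = L as soon as 1 < L, so
   the matrices below are the L x L matrices indexed by Z/L.  For L <= 1 they
   are 2 x 2 matrices without meaning.  The successor form of the dimension
   provides the ring structure with inverses, hence integer powers. *)

(* Multiplication by the Laurent polynomial on R[x]/(x^L - 1) in the basis
   1, x, ..., x^(L-1): the (i', i) entry sums c_k over k = i' - i mod L. *)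
Definition laurent_mx (R : nzRingType) (L : nat) (c : int -> R) (a b : int)
    : 'M[R]_((Zp_trunc L).+2) :=
  \matrix_(i', i)
    \sum_(k <- zrange a b | k%:~R == (i' : 'Z_L) - i) c k.

Definition supported_in (R : nzRingType) (L : nat) (lo hi : int)
    (A : 'M[R]_((Zp_trunc L).+2)) : Prop :=
  forall i' i : 'Z_L, A i' i != 0 ->
    exists d : int, lo <= d <= hi /\ i' - i = d%:~R.

(* Main.v *)
(** Write [W_n = (F^n)^T W F^n] and [d = kb - ka > 0].  One step reads
    [W_(n+1) i' i = \sum_(k, l) c_k c_l W_n (i' + k) (i + l)].  If every [W_n] is
    supported on the diagonals [lo .. t], then on the diagonal [t + d] only
    [(k, l) = (ka, kb)] contributes, provided that [L] is too large for the band
    to wrap around; and [W_(n+1)] vanishes there.  So the diagonal [t] of [W_n] is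
    zero, and the band shrinks from the top until nothing is left. *)
Require Import Defs.
From mathcomp Require Import all_boot all_order all_algebra.
From mathcomp Require Import zify ring.

Set Implicit Arguments.
Unset Strict Implicit.
Unset Printing Implicit Defensive.

Import Order.TTheory GRing.Theory Num.Theory.
Local Open Scope ring_scope.

Lemma Zp_intr_inj (L : nat) (d e : int) :
  (1 < L)%N -> `|d - e| < L%:Z -> d%:~R = e%:~R :> 'Z_L -> d = e.
Proof.
move=> L1 small /eqP; rewrite -subr_eq0 -rmorphB /= => /eqP de0.
have abs0 : (`|d - e|%N)%:R = 0 :> 'Z_L.
  by case: (d - e) de0 => m //=; rewrite NegzE rmorphN => /eqP;
    rewrite oppr_eq0 => /eqP.
have := congr1 (@nat_of_ord _) abs0; rewrite val_Zp_nat //= modn_small; last by lia.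
by lia.
Qed.

Lemma laurent_mx_conjE (R : comNzRingType) (L : nat) (c : int -> R) (a b : int)
    (W : 'M[R]_((Zp_trunc L).+2)) (i' i : 'Z_L) :
  let F := laurent_mx L c a b in
  (F^T *m W *m F) i' i =
  \sum_(k <- zrange a b) \sum_(l <- zrange a b)
    c k * c l * W (i' + k%:~R) (i + l%:~R).
Proof.
move=> F.
have FE (g : 'Z_L -> R) (j : 'Z_L) :
    \sum_m F m j * g m = \sum_(k <- zrange a b) c k * g (j + k%:~R).
  under eq_bigr => m _ do rewrite mxE mulr_suml big_mkcond /=.
  rewrite exchange_big /=; apply: eq_bigr => k _.
  (* For fixed [k], the condition [k = m - j] in 'Z_L selects the single row [m = j + k]. *)
  rewrite (bigD1 (j + k%:~R)) //= addrAC subrr add0r eqxx big1 ?addr0 // => m.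
  by rewrite eq_sym [_ == m - j]eq_sym subr_eq addrC eq_sym => /negbTE ->.
rewrite -mulmxA mxE.
under eq_bigr => m _ do rewrite mxE.
rewrite FE; apply: eq_bigr => k _.
rewrite mxE; under eq_bigr => m _ do rewrite mulrC.
rewrite FE mulr_sumr; apply: eq_bigr => l _; exact: mulrA.
Qed.

(** A nonzero entry of [W] on diagonal [t] would reappear, scaled by [c a * c b != 0], on diagonal
    [t + b - a] of the conjugate, outside its band. *)
Lemma supported_in_shrink (R : idomainType) (L : nat) (c : int -> R)
    (a b lo t : int) (W : 'M[R]_((Zp_trunc L).+2)) :
  let F := laurent_mx L c a b in
  (1 < L)%N -> a < b -> c a != 0 -> c b != 0 ->
  lo <= t -> t - lo + 2 * (b - a) < L%:Z ->
  supported_in (L := L) lo t W ->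
  supported_in (L := L) lo t (F^T *m W *m F) ->
  supported_in (L := L) lo (t - 1) W.
Proof.
move=> F L1 ab ca cb lot small sW sFW j' j Wj.
have [d [dbnd dE]] := sW _ _ Wj.
have [dt|dt] := eqVneq d t; last by exists d; split=> //; lia.
subst d; exfalso.
(* Chosen so that the pair [(a, b)] reads exactly the entry [(j', j)]. *)
pose i' : 'Z_L := j' - a%:~R; pose i : 'Z_L := j - b%:~R.
have iE : i' - i = (t + b - a)%:~R.
  rewrite /i' /i !rmorphB !rmorphD /= -dE.
  ring.
(* The entry lies on diagonal [t + b - a + k - l], between [t] and [t + 2 * (b - a)]. Its distance
   to any [e] in [[lo, t]] is below [L], so congruence forces equality, hence [e = t], [k = a] and
   [l = b]. *)
have W0 k l : a <= k <= b -> a <= l <= b -> (k, l) != (a, b) ->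
    W (i' + k%:~R) (i + l%:~R) = 0.
  move=> kab lab kl; apply/eqP/negP => /negP /sW [e [ebnd]].
  rewrite opprD addrACA iE -!rmorphB -!rmorphD /= => /Zp_intr_inj eE.
  have : ~~ ((k == a) && (l == b)) by [].
  have := eE L1; lia.
have FW : (F^T *m W *m F) i' i = c a * c b * W j' j.
  rewrite laurent_mx_conjE.
  rewrite (bigD1_seq a) ?zrange_uniq ?mem_zrange /=; [|lia|by []].
  rewrite [X in _ + X]big_seq_cond [X in _ + X]big1 => [|k /andP[]]; last first.
    rewrite mem_zrange => kab ka; rewrite big_seq big1 // => l.
    rewrite mem_zrange => lab; rewrite W0 ?mulr0 //.
    by rewrite xpair_eqE (negbTE ka).
  rewrite addr0 (bigD1_seq b) ?zrange_uniq ?mem_zrange /=; [|lia|by []].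
  rewrite !subrK big_seq_cond big1 ?addr0 // => l /andP[].
  rewrite mem_zrange => lab lb.
  suff -> : W j' (i + l%:~R) = 0 by rewrite mulr0.
  rewrite -[j'](subrK a%:~R); apply: W0 => //; first by lia.
  by rewrite xpair_eqE eqxx.
have /sFW [e [ebnd]] : (F^T *m W *m F) i' i != 0 by rewrite FW !mulf_neq0.
by rewrite iE => /Zp_intr_inj eE; have := eE L1; lia.
Qed.

Theorem mainTheorem2 (p : nat) (ka kb : int) (c : int -> 'F_p) (lx ly : nat)
    (p_prime : prime p) (ka_lt_kb : ka < kb)
    (c_ka : c ka != 0) (c_kb : c kb != 0)
    (f1 : laurent_eval c ka kb 1 != 0) :
  exists N0 : nat, forall N : nat, (N0 <= N)%N ->
    let L := (p ^ N)%N in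
    let F := laurent_mx L c ka kb in
    forall W : 'M['F_p]_((Zp_trunc L).+2),
      (forall n : int,
         supported_in (L := L)
           (- lx%:Z - 2 * ly%:Z * kb) (lx%:Z - 2 * ly%:Z * ka)
           ((F ^ n)^T *m W *m F ^ n)) ->
      W = 0.
Proof.
pose d := `|kb - ka|%N.
(* This is [hi - lo + 2 * (kb - ka)], the size that [L] must exceed; [N < p ^ N] does the rest. *)
exists (2 * lx + 2 * ly * d + 2 * d)%N => N leN L F W sW.
have ltL : (2 * lx + 2 * ly * d + 2 * d < L)%N.
  by apply: leq_ltn_trans leN _; rewrite ltn_expl // prime_gt1.
have L1 : (1 < L)%N by rewrite /d in ltL *; lia.
set lo := - lx%:Z - _ in sW; set hi := lx%:Z - _ in sW.
have width : hi - lo + 2 * (kb - ka) < L%:Z.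
  have dE : d%:Z = kb - ka by rewrite /d; lia.
  have -> : hi - lo + 2 * (kb - ka) = (2 * lx + 2 * ly * d + 2 * d)%N%:Z.
    by rewrite !PoszD !PoszM dE /hi /lo; lia.
  by rewrite ltz_nat.
pose V n := (F ^+ n)^T *m W *m F ^+ n.
have VS n : V n.+1 = F^T *m V n *m F.
  by rewrite /V exprSr -mulmxE trmx_mul !mulmxA.
(* Uniform in [n], since shrinking the band of [V n] uses the bounds on both [V n] and [V n.+1]. *)
have shrink (j n : nat) : supported_in (L := L) lo (hi - j%:Z) (V n).
  elim: j n => [|j IHj] n; first by rewrite subr0; exact: (sW n).
  have [lot|tlo] := leP lo (hi - j%:Z); last first.
    by move=> i' i /IHj [e [ebnd _]]; lia.
  have -> : hi - j.+1%:Z = hi - j%:Z - 1 by lia.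
  apply: (supported_in_shrink L1 ka_lt_kb c_ka c_kb lot) => //; first by lia.
  by rewrite -VS.
have V0 : V 0%N = W by rewrite /V expr0 trmx1 mul1mx mulmx1.
apply/matrixP => i' i; rewrite mxE; apply/eqP/negP => /negP.
(* After this many steps the upper end is below [lo]: the band is empty. *)
rewrite -V0 => /(shrink `|hi - lo|.+1 0%N) [e [ebnd _]]; lia.
Qed.
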